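(* For all integers $n,r,s,k\ge 0$ and every triple $(t,u,\ell)\in G\cup H\cup I\cup J\cup K\cup L\cup M\cup N\cup O\cup P$, where \begin{align*} G&=\{(4,2,8),(1,5,5),(7,8,2),(2,1,7),(8,4,4),(5,7,1)\},\\ H&=\{(7,2,2),(4,5,8),(1,8,5),(8,1,4),(5,4,1),(2,7,7)\},\\ I&=\{(1,1,5),(4,4,8),(7,7,2),(2,2,7),(5,5,1),(8,8,4)\},\\ J&=\{(7,1,2),(1,4,5),(4,7,8),(5,2,1),(8,5,4),(2,8,7)\},\\ K&=\{(2,6,7),(5,6,1),(8,6,4),(1,3,5),(4,3,8),(7,3,2)\},\\ L&=\{(2,3,7),(5,3,1),(8,3,4),(1,6,5),(4,6,8),(7,6,2)\},\\ M&=\{(8,1,5),(5,4,8),(2,7,2),(7,2,7),(4,5,1),(1,8,4)\},\\ N&=\{(5,1,8),(2,4,2),(8,7,5),(1,2,4),(7,5,7),(4,8,1)\},\\ O&=\{(4,1,1),(7,4,7),(1,7,4),(8,2,5),(2,5,2),(5,8,8)\},\\ P&=\{(1,1,4),(4,4,1),(7,7,7),(2,2,2),(5,5,8),(8,8,5)\}, \end{align*} we have \[\bar{b}^{9k+\ell}_{9r+t,\,9s+u}(9n+6)\equiv 0\pmod{3}.\]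
   Context: Write $f_m=\prod_{i\ge 1}(1-q^{mi})$ for $m\ge 1$, and $f_m^a$ for its $a$-th power. For integers $r,s,k\ge 1$, $\bar{b}^k_{r,s}(n)$ denotes the number of overcolored partition $k$-tuples of $n$: $k$-tuples of partitions of total weight $n$ in which each even part may appear in one of $r$ colors, each odd part may appear in one of $s$ colors, and the first occurrence of each part (of each color) in each component may be overlined. Equivalently, as formal power series in $q$, \[\sum_{n=0}^{\infty}\bar{b}^k_{r,s}(n)q^n=\frac{f_2^{(3s-2r)k}}{f_1^{2sk}f_4^{(s-r)k}}.\] (The superscript is the number of components of the tuple, not a power.) *)

(* Defs.v *)
From mathcomp Require Import all_boot.

Set Implicit Arguments.
Unset Strict Implicit.
Unset Printing Implicit Defensive.

Definition ncolors (r s i : nat) : nat := if odd i then s else r.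

(* [Tagged _ c] with tag [i : 'I_n] is the part [i.+1] in color [c]. *)
Notation colored_part r s n := {i : 'I_n & 'I_(ncolors r s i.+1)}.

Definition part_size (r s n : nat) (p : colored_part r s n) : nat := (tag p).+1.

(* A partition is given by the multiplicity of each colored part, together with
   a flag telling whether its first occurrence is overlined.  The argument [n]
   bounds the parts and the multiplicities, which loses nothing in a partition
   of weight at most [n]. *)
Notation overcolored_data r s n := {ffun colored_part r s n -> 'I_n.+1 * bool}.

Definition is_overcolored_partition (r s n : nat)
    (lam : overcolored_data r s n) : bool :=
  [forall p, (lam p).2 ==> (0 < (lam p).1)].

Definition weight (r s n : nat) (lam : overcolored_data r s n) : nat :=
  \sum_p (lam p).1 * part_size p.

Definition bbar (k r s n : nat) : nat :=
  #|[set Lam : {ffun 'I_k -> overcolored_data r s n} |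
      [forall j, is_overcolored_partition (Lam j)]
      && (\sum_(j < k) weight (Lam j) == n)]|.

Definition triples_G : seq (nat * nat * nat) :=
  [:: (4, 2, 8); (1, 5, 5); (7, 8, 2); (2, 1, 7); (8, 4, 4); (5, 7, 1)].
Definition triples_H : seq (nat * nat * nat) :=
  [:: (7, 2, 2); (4, 5, 8); (1, 8, 5); (8, 1, 4); (5, 4, 1); (2, 7, 7)].
Definition triples_I : seq (nat * nat * nat) :=
  [:: (1, 1, 5); (4, 4, 8); (7, 7, 2); (2, 2, 7); (5, 5, 1); (8, 8, 4)].
Definition triples_J : seq (nat * nat * nat) :=
  [:: (7, 1, 2); (1, 4, 5); (4, 7, 8); (5, 2, 1); (8, 5, 4); (2, 8, 7)].
Definition triples_K : seq (nat * nat * nat) :=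
  [:: (2, 6, 7); (5, 6, 1); (8, 6, 4); (1, 3, 5); (4, 3, 8); (7, 3, 2)].
Definition triples_L : seq (nat * nat * nat) :=
  [:: (2, 3, 7); (5, 3, 1); (8, 3, 4); (1, 6, 5); (4, 6, 8); (7, 6, 2)].
Definition triples_M : seq (nat * nat * nat) :=
  [:: (8, 1, 5); (5, 4, 8); (2, 7, 2); (7, 2, 7); (4, 5, 1); (1, 8, 4)].
Definition triples_N : seq (nat * nat * nat) :=
  [:: (5, 1, 8); (2, 4, 2); (8, 7, 5); (1, 2, 4); (7, 5, 7); (4, 8, 1)].
Definition triples_O : seq (nat * nat * nat) :=
  [:: (4, 1, 1); (7, 4, 7); (1, 7, 4); (8, 2, 5); (2, 5, 2); (5, 8, 8)].
Definition triples_P : seq (nat * nat * nat) :=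
  [:: (1, 1, 4); (4, 4, 1); (7, 7, 7); (2, 2, 2); (5, 5, 8); (8, 8, 5)].

(* Main.v *)
Require Import Defs.
From mathcomp Require Import all_boot all_algebra zify ring.

(* Let E and O be the products of (1 - q^i)/(1 + q^i) over the even and the odd i.
   The generating function of \bar b^k_{r,s} is E^(-rk) O^(-sk).  Modulo 3 the ninth
   power of a series is a series in q^9, so only rk and sk modulo 9 matter, and each
   of the ten families of triples has a single such pair of residues.  By Gauss's
   identity E O = phi(-q), E / O = phi(q) and E = phi(-q^2), where
   phi(q) = \sum_j q^(j^2), and in each family the generating function is, up to a
   series in q^9, of the form F(q)^3 G(q) with F one of phi(q), phi(-q) and G one of
   phi(q), phi(-q), phi(-q^2), phi(q)^2, phi(-q)^2.  The exponents of G are of the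
   form j^2, 2j^2 or j^2 + m^2, hence divisible by 9 as soon as they are divisible
   by 3, and those of F(q)^3 = F(q^3) are of the form 3j^2.  An exponent 9n + 6 would
   thus require 3j^2 = 6 modulo 9, i.e. j^2 = 2 modulo 3. *)

Set Implicit Arguments.
Unset Strict Implicit.
Unset Printing Implicit Defensive.

Import GRing.Theory.
Local Open Scope ring_scope.

(** * Gauss's identity for phi(-q) in finite form *)

Section Gauss.
Variables (R : comNzRingType) (q : R).

(* The truncation of [\phi(-q) = \sum_j (-1)^j q^(j^2)], [j] ranging over [-n .. n]. *)
Definition theta (n : nat) : R :=
  1 + \sum_(j < n) (-1) ^+ j.+1 * 2 * q ^+ (j.+1 ^ 2).

(* Terms of Shanks' finite form of Gauss's identity, cleared of denominators.
   Modulo [q^(n+1)] only the term [s = 0] survives. *)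
Definition shanks (n s : nat) : R :=
  (-1) ^+ s * (\prod_(i < s.-1) (1 + q ^+ i.+1)) * (if s == 0 then 1 else 2) *
  (\prod_(s <= i < n) (1 - q ^+ i.+1)) * q ^+ (s * n.+1).

(** Telescoping in [m]. At [m = n], adding the remaining term [shanks n.+1 n.+1] yields the new
    summand of [theta] times the product up to [n.+1], which is the induction step of
    [theta_shanks]. *)
Lemma shanks_step n m : (m < n.+1)%N ->
  \sum_(s < m.+1) (shanks n.+1 s - (1 + q ^+ n.+1) * shanks n s) =
  (-1) ^+ m.+1 * 2 * (\prod_(i < m) (1 + q ^+ i.+1)) *
  (\prod_(m <= i < n) (1 - q ^+ i.+1)) * q ^+ (m.+1 * n.+1).
Proof.
elim: m => [|m IH] mn; rewrite big_ord_recr /=.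
  rewrite big_ord0 /shanks /= !big_ord0 big_nat_recr //= !mul0n mul1n; ring.
rewrite {}IH; last by apply: ltnW.
rewrite /shanks /= (@big_ltn _ _ _ m n); last by [].
rewrite (@big_nat_recr _ _ _ n m.+1) //= big_ord_recr /=.
have -> : (m.+1 * n.+2 = m.+1 * n.+1 + m.+1)%N by lia.
have -> : (m.+2 * n.+1 = m.+1 * n.+1 + n.+1)%N by lia.
rewrite !exprD !(exprS (-1) _).
ring.
Qed.

Lemma theta_shanks n :
  theta n * \prod_(i < n) (1 + q ^+ i.+1) = \sum_(s < n.+1) shanks n s.
Proof.
elim: n => [|n IH].
  rewrite /theta !big_ord0 big_ord_recr big_ord0 /shanks /= big_ord0 big_geq //.
  by rewrite !mul0n; ring.
have := @shanks_step n n (leqnn _).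
rewrite sumrB -mulr_sumr -IH big_geq // => /eqP; rewrite subr_eq => /eqP E.
rewrite [in RHS]big_ord_recr /= E.
rewrite /shanks /= (@big_geq _ _ _ n.+1) // /theta (@big_ord_recr _ _ _ n) /=.
rewrite (@big_ord_recr _ _ _ n) /=.
rewrite -mulnn.
have -> : (n.+1 * n.+2 = n.+1 * n.+1 + n.+1)%N by lia.
rewrite !exprD; ring.
Qed.

Lemma theta_prod n : q ^+ n.+1 = 0 ->
  theta n * \prod_(i < n) (1 + q ^+ i.+1) = \prod_(i < n) (1 - q ^+ i.+1).
Proof.
move=> q0; rewrite theta_shanks big_ord_recl big1 => [|i _].
  by rewrite /shanks /= big_ord0 mul0n addr0 !mulr1 !mul1r big_mkord.
by rewrite /shanks [(_ * n.+1)%N]mulnC exprM q0 expr0n mulr0.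
Qed.

End Gauss.

(** * Even and odd products in terms of theta series *)

Lemma geometric_nilp (R : comNzRingType) (t : R) m :
  t ^+ m = 0 -> (1 - t) * (\sum_(i < m) t ^+ i) = 1.
Proof. by move=> t0; rewrite -[LHS]opprK -mulNr opprB -subrX1 t0 sub0r opprK. Qed.

Section Products.
Variables (R : comNzRingType) (n : nat).

(* The generating function of the multiplicity and the overline flag of one
   colored part of weight [i], where [t = q^i]. *)
Definition overseries (t : R) : R :=
  \sum_(p : 'I_n.+1 * bool | p.2 ==> (0 < p.1)%N) t ^+ p.1.

Lemma overseriesP (t : R) : t ^+ n.+1 = 0 -> (1 - t) * overseries t = 1 + t.
Proof.
move=> /geometric_nilp geo.
(* The first sum has no overline; in the second the overline excludes multiplicity 0. *)
have -> : overseries t = \sum_(i < n.+1) t ^+ i + (\sum_(i < n.+1) t ^+ i - 1).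
  transitivity (\sum_(i < n.+1) \sum_(b : bool | b ==> (0 < i)%N) t ^+ i).
    by rewrite pair_big_dep.
  transitivity (\sum_(i < n.+1) (t ^+ i + (if (0 < i)%N then t ^+ i else 0))).
    apply: eq_bigr => i _; rewrite big_mkcond big_bool /=.
    by rewrite addrC.
  rewrite big_split /=; congr (_ + _).
  rewrite !big_ord_recl /= add0r expr0 addrC addKr.
  by apply: eq_bigr.
rewrite !mulrDr geo; ring.
Qed.

Lemma inv_1subr_nilp (t : R) m : t ^+ m = 0 -> exists u, (1 - t) * u = 1.
Proof. by move/geometric_nilp; exists (\sum_(i < m) t ^+ i). Qed.

Lemma inv_prod m (F : 'I_m -> R) :
  (forall i, exists u, F i * u = 1) -> exists u, (\prod_i F i) * u = 1.
Proof.
move=> H; apply: (big_ind (fun a => exists u, a * u = 1)) => [|a b [u au] [v bv]|//].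
- by exists 1; rewrite mulr1.
- by exists (u * v); rewrite mulrACA au bv mulr1.
Qed.

Lemma inv_cancel (c a b : R) : (exists u, c * u = 1) -> a * c = b * c -> a = b.
Proof.
by case=> u cu /(congr1 (fun w => w * u)); rewrite -!mulrA cu !mulr1.
Qed.

Lemma prod_even_odd (F : nat -> R) m :
  \prod_(i < m) F i.+1 =
  (\prod_(j < m./2) F j.+1.*2) * \prod_(j < uphalf m) F j.*2.+1.
Proof.
elim: m => [|m IH]; first by rewrite !big_ord0 mulr1.
rewrite big_ord_recr {}IH -uphalfE /= uphalf_half.
have := odd_double_half m; case: (odd m) => /= mE.
  rewrite !add1n (@big_ord_recr _ _ _ m./2 (fun i => F i.+1.*2)) /=.
  rewrite doubleS; have <- : m.+1 = m./2.*2.+2 by rewrite -[in LHS]mE.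
  by rewrite mulrAC.
rewrite add0n (@big_ord_recr _ _ _ m./2 (fun j => F j.*2.+1)) /=.
by rewrite (_ : m./2.*2 = m) ?mulrA.
Qed.

Variables (q : R).
Hypothesis q0 : q ^+ n.+1 = 0.

Definition even_series := \prod_(j < n./2) overseries (q ^+ j.+1.*2).
Definition odd_series := \prod_(j < uphalf n) overseries (q ^+ j.*2.+1).

Let Me := \prod_(j < n./2) (1 - q ^+ j.+1.*2).
Let Mo := \prod_(j < uphalf n) (1 - q ^+ j.*2.+1).
Let De := \prod_(j < n./2) (1 + q ^+ j.+1.*2).
Let Do := \prod_(j < uphalf n) (1 + q ^+ j.*2.+1).

Let qX m : (q ^+ m.+1) ^+ n.+1 = 0.
Proof. by rewrite -exprM mulnC exprM q0 expr0n. Qed.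

Let even_seriesP : even_series * Me = De.
Proof.
by rewrite mulrC -big_split /=; apply: eq_bigr => i _; rewrite overseriesP ?qX.
Qed.

Let odd_seriesP : odd_series * Mo = Do.
Proof.
by rewrite mulrC -big_split /=; apply: eq_bigr => i _; rewrite overseriesP ?qX.
Qed.

Let inv_Me : exists u, Me * u = 1.
Proof. by apply: inv_prod => i; apply: inv_1subr_nilp (qX _). Qed.

Let inv_Mo : exists u, Mo * u = 1.
Proof. by apply: inv_prod => i; apply: inv_1subr_nilp (qX _). Qed.

Lemma theta_sq_series : theta (q ^+ 2) n./2 * even_series = 1.
Proof.
apply: (inv_cancel inv_Me); rewrite -mulrA even_seriesP mul1r.
have q20 : (q ^+ 2) ^+ n./2.+1 = 0.
  rewrite -exprM; have -> : (2 * n./2.+1 = n.+1 + ~~ odd n)%N.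
    by have := odd_double_half n; lia.
  by rewrite exprD q0 mul0r.
have E (i : nat) : (q ^+ 2) ^+ i.+1 = q ^+ i.+1.*2 by rewrite -exprM mul2n.
have := theta_prod q20.
under eq_bigr do rewrite E.
by under [in RHS]eq_bigr do rewrite E.
Qed.

Lemma theta_series : theta q n * (even_series * odd_series) = 1.
Proof.
apply: (inv_cancel inv_Me); apply: (inv_cancel inv_Mo).
have -> : theta q n * (even_series * odd_series) * Me * Mo =
  theta q n * ((even_series * Me) * (odd_series * Mo)) by ring.
rewrite even_seriesP odd_seriesP mul1r.
have := theta_prod q0.
by rewrite (prod_even_odd (fun i => 1 + q ^+ i)) (prod_even_odd (fun i => 1 - q ^+ i)).
Qed.

(** Replacing [q] by [- q] in Gauss's identity swaps [1 + q^i] and [1 - q^i] for odd [i] only, so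
    [theta (- q) n * De * Mo = Me * Do]. *)
Lemma theta_opp_series : theta (- q) n * even_series = odd_series.
Proof.
apply: (inv_cancel inv_Me); apply: (inv_cancel inv_Mo).
have -> : odd_series * Me * Mo = Me * (odd_series * Mo) by ring.
rewrite -(mulrA (theta _ _)) even_seriesP odd_seriesP.
have nq0 : (- q) ^+ n.+1 = 0 by rewrite exprNn q0 mulr0.
have E (i : nat) : (- q) ^+ i.*2 = q ^+ i.*2.
  by rewrite exprNn -signr_odd odd_double mul1r.
have O (i : nat) : (- q) ^+ i.*2.+1 = - q ^+ i.*2.+1.
  by rewrite exprS E mulNr -exprS.
have := theta_prod nq0.
rewrite (prod_even_odd (fun i => 1 + (- q) ^+ i)).
rewrite (prod_even_odd (fun i => 1 - (- q) ^+ i)).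
under eq_bigr do rewrite E.
under [X in _ * (_ * X) = _]eq_bigr do rewrite O.
under [X in _ = X * _]eq_bigr do rewrite E.
under [X in _ = _ * X]eq_bigr do rewrite O opprK.
by rewrite mulrA.
Qed.

End Products.

(** * Generating function of overcolored partition tuples *)

Lemma bbar_coef (R : comNzRingType) (k r s n : nat) :
  (bbar k r s n)%:R =
  ((even_series n ('X : {poly R}) ^+ r * odd_series n 'X ^+ s) ^+ k)`_n.
Proof.
have partition_gf : even_series n ('X : {poly R}) ^+ r * odd_series n 'X ^+ s =
    \sum_(lam : overcolored_data r s n | is_overcolored_partition lam)
      'X^(weight lam).
  transitivity (\prod_(p : colored_part r s n)
                 overseries n ('X^(part_size p) : {poly R})).
    rewrite (eq_bigl (fun p : colored_part r s n => true && true)) //.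
    rewrite -(sig_big_dep (J := fun i : 'I_n => 'I_(ncolors r s i.+1))
      xpredT (fun _ => xpredT)
      (fun i _ => overseries n ('X^(i.+1) : {poly R}))) /=.
    under eq_bigr do rewrite prodr_const card_ord /ncolors.
    rewrite (prod_even_odd (fun i => overseries n ('X^i) ^+ (if odd i then s else r))).
    rewrite /even_series /odd_series -!prodrXl; congr (_ * _).
      by apply: eq_bigr => i _; rewrite odd_double.
    by apply: eq_bigr => i _; rewrite /= odd_double.
  (* Expanding the product chooses a multiplicity and a flag for every colored part, that is, a
     partition [lam]. *)
  rewrite /overseries bigA_distr_big_dep; apply: eq_big => [lam|lam _].
    by apply/familyP/forallP => H p; apply: H.
  rewrite /weight -prodrXr; apply: eq_bigr => p _.
  by rewrite -exprM mulnC.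
rewrite partition_gf -[in RHS](card_ord k) -prodr_const bigA_distr_big_dep coef_sum.
rewrite /bbar -sum1_card natr_sum.
rewrite (eq_bigl (fun Lam : {ffun 'I_k -> overcolored_data r s n} =>
  (Lam \in family (fun _ : 'I_k => @is_overcolored_partition r s n))
  && (\sum_(j < k) weight (Lam j) == n))); last first.
  by move=> Lam; rewrite inE; congr (_ && _); apply/forallP/familyP.
rewrite big_mkcondr; apply: eq_bigr => Lam _.
by rewrite prodrXr coefXn eq_sym; case: eqP.
Qed.

(** * Transfer to truncated power series *)

Section Morphism.
Variables (R S : comNzRingType) (f : {rmorphism R -> S}).

Lemma rmorph_theta q n : f (theta q n) = theta (f q) n.
Proof.
rewrite /theta rmorphD rmorph1 rmorph_sum; congr (_ + _).
by apply: eq_bigr => j _; rewrite !rmorphM rmorph_nat !rmorphXn rmorphN1.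
Qed.

Lemma rmorph_overseries n t : f (overseries n t) = overseries n (f t).
Proof. by rewrite rmorph_sum; apply: eq_bigr => p _; rewrite rmorphXn. Qed.

Lemma rmorph_even_series n q : f (even_series n q) = even_series n (f q).
Proof.
by rewrite rmorph_prod; apply: eq_bigr => j _; rewrite rmorph_overseries rmorphXn.
Qed.

Lemma rmorph_odd_series n q : f (odd_series n q) = odd_series n (f q).
Proof.
by rewrite rmorph_prod; apply: eq_bigr => j _; rewrite rmorph_overseries rmorphXn.
Qed.

End Morphism.

Section Truncation.
Variables (R : comNzRingType) (n : nat).

Lemma in_qpoly_coef (p r : {poly R}) i : (i <= n)%N ->
  in_qpoly 'X^(n.+1) p = in_qpoly 'X^(n.+1) r -> p`_i = r`_i.
Proof.
move=> le_in /(congr1 (fun w => (polyn w)`_i)) /=.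
by rewrite mk_monic_Xn -!Pdiv.RingMonic.take_poly_rmodp !coef_take_poly ltnS le_in.
Qed.

Lemma in_qpolyX_expn : in_qpoly ('X^(n.+1) : {poly R}) 'X ^+ n.+1 = 0.
Proof.
rewrite -rmorphXn; apply/val_inj => /=.
by rewrite mk_monic_Xn -Pdiv.RingMonic.take_poly_rmodp -['X^_]mul1r take_polyMXn_0.
Qed.

End Truncation.

(** * Supports of powers, products and theta series *)

Lemma coef_exp_pchar (R : comNzRingType) p (F : {poly R}) i :
  p \in [pchar R] -> (F ^+ p)`_i != 0 -> exists2 j, i = (p * j)%N & F`_j != 0.
Proof.
move=> pR; have pP : p \in [pchar {poly R}] by rewrite pchar_poly.
(* The Frobenius map is additive in characteristic [p]. *)
have -> : F ^+ p = \sum_(j < size F) F`_j ^+ p *: 'X^(p * j).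
  rewrite -(pFrobenius_autE pP) -[F in LHS]coefK poly_def rmorph_sum.
  by apply: eq_bigr => j _; rewrite /= pFrobenius_autE exprZn -exprM mulnC.
have [/existsP[j /andP[Fj /eqP ij]] _|/existsPn H] :=
  boolP [exists j : 'I_(size F), (F`_j != 0) && (i == p * j)%N].
  by exists j.
rewrite coef_sum big1 ?eqxx // => j _; have := H j.
rewrite negb_and negbK coefZ coefXn => /orP[/eqP -> | /negPf ->].
  by rewrite expr0n eqn0Ngt prime_gt0 ?(pcharf_prime pR) // mul0r.
by rewrite mulr0.
Qed.

Lemma coef_mul_neq0 (R : comNzRingType) (F G : {poly R}) i : (F * G)`_i != 0 ->
  exists a b, [/\ i = (a + b)%N, F`_a != 0 & G`_b != 0].
Proof.
have [/existsP[j /andP[Fj Gj]] _|/existsPn H] :=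
  boolP [exists j : 'I_i.+1, (F`_j != 0) && (G`_(i - j) != 0)].
  by exists j, (i - j)%N; split => //; rewrite subnKC // -ltnS.
rewrite coefM big1 ?eqxx // => j _; have := H j; rewrite negb_and !negbK.
by case/orP => /eqP ->; rewrite ?mul0r ?mulr0.
Qed.

Lemma coef_theta (R : comNzRingType) (c : R) e n i :
  (theta (c *: 'X^e) n)`_i != 0 -> exists j, i = (e * j ^ 2)%N.
Proof.
rewrite /theta coefD coef1 coef_sum.
case: (i =P 0%N) => [-> _|_]; first by exists 0%N; rewrite muln0.
rewrite add0r; have [/existsP[j /eqP ij] _|/existsPn H] :=
  boolP [exists j : 'I_n, i == (e * j.+1 ^ 2)%N]; first by exists j.+1.
rewrite big1 ?eqxx // => j _.
have -> : (-1) ^+ j.+1 * 2 = ((-1) ^+ j.+1 * 2 : R)%:P :> {poly R}.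
  by rewrite rmorphM rmorphXn rmorphN1 rmorph_nat.
by rewrite exprZn -exprM coefCM coefZ coefXn (negPf (H j)) !mulr0.
Qed.

Lemma coef_cube_vanish (C F G : {poly 'F_3}) n :
    (forall i, F`_i != 0 -> (i %% 3 != 2)%N) ->
    (forall i, G`_i != 0 -> (3 %| i)%N -> (9 %| i)%N) ->
  (C ^+ 9 * (F ^+ 3 * G))`_(9 * n + 6) = 0.
Proof.
(* A nonzero term yields [9 i2 + 3 a1 + b = 9 n + 6], so [9 %| b] and [a1 = 2 %[mod 3]]. *)
move=> hF hG; apply/eqP/negPn/negP.
case/coef_mul_neq0 => i [m [im]].
have ch : 3%N \in [pchar 'F_3] by apply: pchar_Fp.
rewrite (exprM C 3 3) => /(coef_exp_pchar ch)[i1 ii1 /(coef_exp_pchar ch)[i2 ii2 _]].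
case/coef_mul_neq0 => a [b [mab /(coef_exp_pchar ch)[a1 aa1 /hF Ha] /hG Hb]].
by lia.
Qed.

(** These residues settle both hypotheses of [coef_cube_vanish]: the nonzero ones are all 1 modulo
    3. *)
Lemma sqr_mod9 j : (j ^ 2 %% 9)%N \in [:: 0; 1; 4; 7]%N.
Proof.
rewrite -modnXm; have: (j %% 9 < 9)%N by rewrite ltn_mod.
by case: (j %% 9)%N => [|[|[|[|[|[|[|[|[|]]]]]]]]].
Qed.

(** * Vanishing of the coefficient at [9 * n + 6] *)

Section Vanishing.
Variables (n m1 m2 : nat).
Let N := (9 * n + 6)%N.
(** Modulo [q^(N+1)], [A] and [B] are 1/E and 1/O, while [x], [y], [z] are phi(-q), phi(q),
    phi(-q^2). *)
Let A : {poly 'F_3} := even_series N 'X.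
Let B : {poly 'F_3} := odd_series N 'X.
Let x : {poly 'F_3} := theta 'X N.
Let y : {poly 'F_3} := theta (- 'X) N.
Let z : {poly 'F_3} := theta ('X ^+ 2) N./2.
Let Gs := [:: x; y; z; x ^+ 2; y ^+ 2].
(* Truncated power series are handled in the quotient by [q^(N+1)]. *)
Let pi : {rmorphism {poly 'F_3} -> {poly %/ ('X^(N.+1) : {poly 'F_3})}} :=
  in_qpoly 'X^(N.+1).

Let xP : pi x * (pi A * pi B) = 1.
Proof.
rewrite /x /A /B rmorph_theta rmorph_even_series rmorph_odd_series.
exact: theta_series (in_qpolyX_expn _ _).
Qed.

Let yP : pi y * pi A = pi B.
Proof.
rewrite /y /A /B rmorph_theta rmorph_even_series rmorph_odd_series rmorphN.
exact: theta_opp_series (in_qpolyX_expn _ _).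
Qed.

Let zP : pi z * pi A = 1.
Proof.
rewrite /z /A rmorph_theta rmorph_even_series rmorphXn.
exact: theta_sq_series (in_qpolyX_expn _ _).
Qed.

Let coef_x i : x`_i != 0 -> exists j, i = (j ^ 2)%N.
Proof.
rewrite /x -(expr1 'X) -['X^1]scale1r => /coef_theta[j ->].
by exists j; rewrite mul1n.
Qed.

Let coef_y i : y`_i != 0 -> exists j, i = (j ^ 2)%N.
Proof.
rewrite /y -(expr1 'X) -scaleN1r => /coef_theta[j ->].
by exists j; rewrite mul1n.
Qed.

Let coef_z i : z`_i != 0 -> exists j, i = (2 * j ^ 2)%N.
Proof. by rewrite /z -['X^2]scale1r => /coef_theta. Qed.

Let coef_series_of_factor F G :
    F \in [:: x; y] -> G \in Gs ->
    (exists c, pi A ^+ m1 * pi B ^+ m2 = pi c ^+ 9 * (pi F ^+ 3 * pi G)) ->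
  (A ^+ m1 * B ^+ m2)`_N = 0.
Proof.
move=> FE GE [c E]; rewrite (in_qpoly_coef (r := c ^+ 9 * (F ^+ 3 * G)) (leqnn N)).
  apply: coef_cube_vanish => i.
    move=> Fi; have [j ->] : exists j, i = (j ^ 2)%N.
      by move: FE Fi; rewrite !inE => /orP[] /eqP ->; [apply: coef_x | apply: coef_y].
    by have := sqr_mod9 j; rewrite !inE; lia.
  move: GE; rewrite !inE => /or4P[/eqP ->|/eqP ->|/eqP ->|/orP[] /eqP ->].
  - by case/coef_x => j ->; have := sqr_mod9 j; rewrite !inE; lia.
  - by case/coef_y => j ->; have := sqr_mod9 j; rewrite !inE; lia.
  - by case/coef_z => j ->; have := sqr_mod9 j; rewrite !inE; lia.
  - rewrite expr2 => /coef_mul_neq0[a [b [-> /coef_x[j ->] /coef_x[k ->]]]].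
    by have := sqr_mod9 j; have := sqr_mod9 k; rewrite !inE; lia.
  - rewrite expr2 => /coef_mul_neq0[a [b [-> /coef_y[j ->] /coef_y[k ->]]]].
    by have := sqr_mod9 j; have := sqr_mod9 k; rewrite !inE; lia.
by move: E; rewrite -!rmorphXn -!rmorphM.
Qed.

(* The ninth power absorbs [A^(9a) B^(9b)]; as [(x A B)^9 = 1], the factor
   [A^6 B^6] amounts to [x^3] up to a ninth power. *)
Let factor_x G : pi A ^+ (m1 %% 9) * pi B ^+ (m2 %% 9) =
    pi A ^+ 6 * pi B ^+ 6 * pi G ->
  exists c, pi A ^+ m1 * pi B ^+ m2 = pi c ^+ 9 * (pi x ^+ 3 * pi G).
Proof.
move=> E; exists (A ^+ (m1 %/ 9).+1 * B ^+ (m2 %/ 9).+1).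
rewrite {1}(divn_eq m1 9) {1}(divn_eq m2 9) !exprD mulrACA E.
rewrite -[_ * pi G]mulr1 -(expr1n _ 3) -xP rmorphM !rmorphXn /=.
rewrite !exprM (exprS _ (m1 %/ 9)) (exprS _ (m2 %/ 9)).
ring.
Qed.

(* As [y A = B], the factor [A^6 B^3] is [A^9 y^3]. *)
Let factor_y G : pi A ^+ (m1 %% 9) * pi B ^+ (m2 %% 9) =
    pi A ^+ 6 * pi B ^+ 3 * pi G ->
  exists c, pi A ^+ m1 * pi B ^+ m2 = pi c ^+ 9 * (pi y ^+ 3 * pi G).
Proof.
move=> E; exists (A ^+ (m1 %/ 9).+1 * B ^+ (m2 %/ 9)).
rewrite {1}(divn_eq m1 9) {1}(divn_eq m2 9) !exprD mulrACA E.
rewrite -yP rmorphM !rmorphXn -yP !exprM (exprS _ (m1 %/ 9)).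
ring.
Qed.

(* The pairs are [(r k, s k)] modulo 9 for the families G, H, ..., P. *)
Lemma coef_series_vanish :
    (m1 %% 9, m2 %% 9)%N \in [:: (5, 7); (5, 4); (5, 5); (5, 2); (5, 6); (5, 3);
                                 (4, 5); (4, 8); (4, 1); (4, 4)]%N ->
  (A ^+ m1 * B ^+ m2)`_N = 0.
Proof.
rewrite !inE !xpair_eqE => H.
have vx G : G \in Gs ->
    pi A ^+ (m1 %% 9) * pi B ^+ (m2 %% 9) = pi A ^+ 6 * pi B ^+ 6 * pi G ->
    (A ^+ m1 * B ^+ m2)`_N = 0.
  move=> GE /factor_x; apply: coef_series_of_factor GE.
  by rewrite inE eqxx.
have vy G : G \in Gs ->
    pi A ^+ (m1 %% 9) * pi B ^+ (m2 %% 9) = pi A ^+ 6 * pi B ^+ 3 * pi G ->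
    (A ^+ m1 * B ^+ m2)`_N = 0.
  move=> GE /factor_y; apply: coef_series_of_factor GE.
  by rewrite !inE eqxx orbT.
have [Gx Gy Gz Gxx Gyy] : [/\ x \in Gs, y \in Gs, z \in Gs,
    x ^+ 2 \in Gs & y ^+ 2 \in Gs].
  by rewrite !inE !eqxx !orbT.
(* Once [B] is replaced by [y A], each case compares two monomials in [A], [x], [y], [z], equal up
   to a power of [x y A^2 = 1] or [z A = 1]. *)
have xP' := xP; rewrite -yP in xP'.
move: vx vy; rewrite -yP.
move: H => /or4P[e|e|e|/or4P[e|e|e|/or4P[e|e|e|e]]];
  case/andP: e => /eqP -> /eqP -> vx vy.
- by apply: (vx _ Gy); ring.
- by apply: (vy _ Gy); ring.
- by apply: (vx _ Gx); rewrite -[LHS]mulr1 -xP'; ring.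
- by apply: (vy _ Gx); rewrite -[LHS]mulr1 -xP'; ring.
- by apply: (vx _ Gz); rewrite -[LHS]mulr1 -zP; ring.
- by apply: (vy _ Gz); rewrite -[LHS]mulr1 -zP; ring.
- by apply: (vy _ Gyy); rewrite rmorphXn; ring.
- by apply: (vx _ Gyy); rewrite rmorphXn; ring.
- by apply: (vy _ Gxx); rewrite rmorphXn -[LHS]mulr1 -(expr1n _ 2) -xP'; ring.
- by apply: (vx _ Gxx); rewrite rmorphXn -[LHS]mulr1 -(expr1n _ 2) -xP'; ring.
Qed.

End Vanishing.

Local Close Scope ring_scope.

Theorem theorem1p14 (n r s k t u l : nat)
  (htul : (t, u, l) \in triples_G ++ triples_H ++ triples_I ++ triples_J
            ++ triples_K ++ triples_L ++ triples_M ++ triples_N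
            ++ triples_O ++ triples_P) :
  bbar (9 * k + l) (9 * r + t) (9 * s + u) (9 * n + 6) = 0 %[mod 3].
Proof.
rewrite mod0n; apply/eqP; rewrite -/(dvdn 3 _) (dvdn_pcharf (pchar_Fp (isT : prime 3))).
rewrite bbar_coef exprMn -!exprM coef_series_vanish //.
have mod9 a b c : ((9 * a + b) * (9 * c + l) = b * l %[mod 9])%N.
  by rewrite -modnMml -modnMmr ![(9 * _)%N]mulnC !modnMDl modnMml modnMmr.
rewrite !mod9.
(* Only [t * l] and [u * l] modulo 9 remain; the sixty triples are checked by computation. *)
have /allP/(_ _ htul) : all (fun p => ((p.1.1 * p.2) %% 9, (p.1.2 * p.2) %% 9)%N \in
    [:: (5, 7); (5, 4); (5, 5); (5, 2); (5, 6); (5, 3);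
        (4, 5); (4, 8); (4, 1); (4, 4)]%N)
  (triples_G ++ triples_H ++ triples_I ++ triples_J ++ triples_K ++ triples_L
     ++ triples_M ++ triples_N ++ triples_O ++ triples_P) by [].
by [].
Qed.
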